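(* Let $\varphi,u_1,u_2:\mathbb R_+^2\to\mathbb R_+$ each satisfy properties (I)–(IV) listed in the context. Let $\mathbf R=(\mathbf r_0,\mathbf r_1,\mathbf r_2)\in(\mathbb R_{++}^2)^3$ be an interior market state, where $\varphi$ is the CFMM trading function and $u_1,u_2$ are the agents' utilities. Then $\mathbf R$ is a unilateral equilibrium if and only if $$p(\varphi,\mathbf r_0)=p(u_1,\mathbf r_1)=p(u_2,\mathbf r_2).$$
   Context: Notation: $\mathbb R_+=[0,\infty)$, $\mathbb R_{++}=(0,\infty)$. For a function $u$ that is differentiable with nonzero partial derivatives at $\mathbf r=(x,y)$, put $p(u,\mathbf r)=p(u,x,y):=\partial_xu(x,y)/\partial_yu(x,y)$. Properties of a function $u:\mathbb R_+^2\to\mathbb R_+$: (I) $u$ is continuous, $u(x,0)=u(0,y)=0$ for all $x,y\in\mathbb R_+$, and $u$ is strictly increasing (in each coordinate) on $\mathbb R_{++}^2$. (II) $\lim_{x'\to\infty}u(x',y)=\infty$ and $\lim_{y'\to\infty}u(x,y')=\infty$ for every $x,y>0$. (III) $u$ is continuously differentiable and strictly concave on $\mathbb R_{++}^2$. (IV) For any $x_1,x_2,y_1,y_2\in\mathbb R_{++}$ with $x_1\le x_2$ and $y_1\ge y_2$, at least one inequality strict, $p(u,x_1,y_1)>p(u,x_2,y_2)$ whenever the prices are defined. Market: there is one constant-function market maker (CFMM) with trading function $\varphi$ and two agents with utilities $u_1,u_2$. A market state is $\mathbf R=(\mathbf r_0,\mathbf r_1,\mathbf r_2)\in(\mathbb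 R_+^2)^3$ ($\mathbf r_0$ = CFMM inventory, $\mathbf r_i$ = holding of agent $i$); it is interior if it lies in $(\mathbb R_{++}^2)^3$. A trade $\mathbf h\in\mathbb R^2$ is valid for $\mathbf R$ and agent $i\in\{1,2\}$ if $\mathbf r_0+\mathbf h\in\mathbb R_+^2$, $\varphi(\mathbf r_0+\mathbf h)=\varphi(\mathbf r_0)$ and $\mathbf r_i-\mathbf h\in\mathbb R_+^2$. A market state is a unilateral equilibrium if for each agent $i\in\{1,2\}$ there is no valid trade $\mathbf h$ with $u_i(\mathbf r_i-\mathbf h)>u_i(\mathbf r_i)$. *)

(* Defs.v *)
From Stdlib Require Import Reals.
From Coquelicot Require Import Coquelicot.

Open Scope R_scope.

Definition nonneg_quadrant (r : R * R) : Prop := 0 <= fst r /\ 0 <= snd r.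
Definition pos_quadrant (r : R * R) : Prop := 0 < fst r /\ 0 < snd r.

Definition partial_x (u : R * R -> R) (r : R * R) : R :=
  Derive (fun x => u (x, snd r)) (fst r).
Definition partial_y (u : R * R -> R) (r : R * R) : R :=
  Derive (fun y => u (fst r, y)) (snd r).

(* [Derive] and division are total, so [price] only carries meaning where
   [price_defined] holds. *)
Definition price_defined (u : R * R -> R) (r : R * R) : Prop :=
  ex_filterdiff u (locally r) /\ partial_x u r <> 0 /\ partial_y u r <> 0.
Definition price (u : R * R -> R) (r : R * R) : R :=
  partial_x u r / partial_y u r.

(* A function from the closed quadrant to [0, oo) is encoded as a total function
   on the plane; its values outside the closed quadrant are never constrained. *)
Definition maps_quadrant_to_nonneg (u : R * R -> R) : Prop :=
  forall r, nonneg_quadrant r -> 0 <= u r.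

(* [continuous_on] is continuity for the subspace topology, so nothing is asked
   across the boundary of the quadrant. *)
Definition property_I (u : R * R -> R) : Prop :=
  continuous_on nonneg_quadrant u /\
  (forall x, 0 <= x -> u (x, 0) = 0) /\
  (forall y, 0 <= y -> u (0, y) = 0) /\
  (forall x1 x2 y, 0 < x1 -> 0 < y -> x1 < x2 -> u (x1, y) < u (x2, y)) /\
  (forall x y1 y2, 0 < x -> 0 < y1 -> y1 < y2 -> u (x, y1) < u (x, y2)).

Definition property_II (u : R * R -> R) : Prop :=
  (forall y, 0 < y -> is_lim (fun x => u (x, y)) p_infty p_infty) /\
  (forall x, 0 < x -> is_lim (fun y => u (x, y)) p_infty p_infty).

Definition continuously_differentiable_on
    (D : R * R -> Prop) (u : R * R -> R) : Prop :=
  forall r, D r ->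
    ex_filterdiff u (locally r) /\
    continuous (partial_x u) r /\ continuous (partial_y u) r.

Definition strictly_concave_on (D : R * R -> Prop) (u : R * R -> R) : Prop :=
  forall (a b : R * R) (t : R), D a -> D b -> a <> b -> 0 < t < 1 ->
    t * u a + (1 - t) * u b < u (plus (scal t a) (scal (1 - t) b)).

Definition property_III (u : R * R -> R) : Prop :=
  continuously_differentiable_on pos_quadrant u /\
  strictly_concave_on pos_quadrant u.

Definition property_IV (u : R * R -> R) : Prop :=
  forall x1 x2 y1 y2,
    0 < x1 -> 0 < x2 -> 0 < y1 -> 0 < y2 ->
    x1 <= x2 -> y2 <= y1 -> x1 < x2 \/ y2 < y1 ->
    price_defined u (x1, y1) -> price_defined u (x2, y2) ->
    price u (x2, y2) < price u (x1, y1).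

Definition properties_I_to_IV (u : R * R -> R) : Prop :=
  maps_quadrant_to_nonneg u /\
  property_I u /\ property_II u /\ property_III u /\ property_IV u.

Definition valid_trade (phi : R * R -> R) (r0 r h : R * R) : Prop :=
  nonneg_quadrant (plus r0 h) /\
  phi (plus r0 h) = phi r0 /\
  nonneg_quadrant (minus r h).

Definition has_improving_trade (phi u : R * R -> R) (r0 r : R * R) : Prop :=
  exists h : R * R, valid_trade phi r0 r h /\ u (minus r h) > u r.

Definition unilateral_equilibrium
    (phi u1 u2 : R * R -> R) (r0 r1 r2 : R * R) : Prop :=
  ~ has_improving_trade phi u1 r0 r1 /\ ~ has_improving_trade phi u2 r0 r2.

(* Main.v *)
(** The gradients of all three functions are positive on the open quadrant, so
    equality of prices means that the gradients of [phi] at [r0] and of [u] at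
    [r] are parallel.  If they are, the tangent plane inequality for concave
    functions shows that a trade on the level curve of [phi] has nonnegative
    value at the common prices, hence cannot improve [u].  If they are not,
    some direction is tangent to the level curve while [u] grows against it.
    Tilting this direction slightly up and down along the second coordinate
    and moving a short time along both brackets the level curve of [phi], and
    the intermediate value theorem gives a point of it between the two; this
    replaces the implicit function theorem. *)

Require Import Defs.
From Stdlib Require Import Reals Lra Ranalysis5.
From Coquelicot Require Import Coquelicot.

Open Scope R_scope.

Lemma is_derive_along_line (u : R * R -> R) (L : R * R -> R) (p q a b s : R) :
  filterdiff u (locally (p + s * a, q + s * b)) L ->
  is_derive (fun t => u (p + t * a, q + t * b)) s (L (a, b)).
Proof.
intros HL.
assert (Hline : filterdiff (fun t : R => (p + t * a, q + t * b)) (locally s)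
                  (fun t : R => (t * a, t * b))).
{ apply (filterdiff_ext_lin _
           (fun t : R => plus (zero : R * R) (scal t ((a, b) : R * R)))).
  - exact (filterdiff_plus_fct _ _ _ _
             (filterdiff_const ((p, q) : R * R)) (filterdiff_scal_l _)).
  - intros t. apply plus_zero_l. }
apply (filterdiff_ext_lin _ (fun t : R => L (t * a, t * b))).
- exact (filterdiff_comp' _ u s _ L Hline HL).
- intros t. destruct HL as [[_ Hscal _] _].
  exact (Hscal t (a, b)).
Qed.

Lemma is_derive_direction (u : R * R -> R) (x y a b : R) :
  ex_filterdiff u (locally (x, y)) ->
  is_derive (fun t => u (x + t * a, y + t * b)) 0
    (partial_x u (x, y) * a + partial_y u (x, y) * b).
Proof.
intros [L HL].
(* The lines start on the axes, at [(0, y)] and [(x, 0)], so that time along them is the coordinate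
   in which the partial derivative is taken. *)
assert (Hx : partial_x u (x, y) = L (1, 0)).
{ apply is_derive_unique; simpl.
  apply (is_derive_ext (fun t => u (0 + t * 1, y + t * 0))).
  - intros t. f_equal; f_equal; ring.
  - apply is_derive_along_line.
    now replace (0 + x * 1, y + x * 0) with (x, y) by (f_equal; ring). }
assert (Hy : partial_y u (x, y) = L (0, 1)).
{ apply is_derive_unique; simpl.
  apply (is_derive_ext (fun t => u (x + t * 0, 0 + t * 1))).
  - intros t. f_equal; f_equal; ring.
  - apply is_derive_along_line.
    now replace (x + y * 0, 0 + y * 1) with (x, y) by (f_equal; ring). }
assert (Hlin : L (a, b) = partial_x u (x, y) * a + partial_y u (x, y) * b).
{ rewrite Hx, Hy. destruct HL as [[Hplus Hscal _] _].
  transitivity (L (plus (scal a (1, 0)) (scal b (0, 1)))).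
  - f_equal. unfold plus, scal; simpl. unfold prod_plus, prod_scal, plus, scal; simpl.
    unfold mult; simpl. f_equal; ring.
  - rewrite Hplus, !Hscal. unfold plus, scal; simpl. unfold mult; simpl. ring. }
rewrite <- Hlin. apply is_derive_along_line.
now replace (x + 0 * a, y + 0 * b) with (x, y) by (f_equal; ring).
Qed.

(** Phrased with [at_right] so that several conditions on small times can be intersected and one
    common time extracted. *)
Lemma at_right_gt_of_derive_pos (f : R -> R) (x l : R) :
  is_derive f x l -> 0 < l -> at_right x (fun t => f x < f t).
Proof.
intros [_ Hf] Hl.
(* An error of slope [l / 2] still leaves a growth of at least [(t - x) * (l / 2)]. *)
assert (He : 0 < l / 2) by lra.
specialize (Hf x (fun P H => H) (mkposreal _ He)).
unfold at_right, within. revert Hf. apply filter_imp. intros t Ht Hxt.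
change (Rabs ((f t - f x) - (t - x) * l) <= l / 2 * Rabs (t - x)) in Ht.
rewrite (Rabs_pos_eq (t - x)) in Ht by lra.
apply Rabs_le_between in Ht.
assert (0 < (t - x) * (l / 2)) by (apply Rmult_lt_0_compat; lra).
nra.
Qed.

Lemma at_right_lt_of_derive_neg (f : R -> R) (x l : R) :
  is_derive f x l -> l < 0 -> at_right x (fun t => f t < f x).
Proof.
intros Hf Hl.
assert (H : at_right x (fun t => - f x < - f t)).
{ apply (at_right_gt_of_derive_pos (fun t => - f t) x (- l)); [ | lra ].
  exact (is_derive_opp f x l Hf). }
revert H. apply filter_imp. intros t; lra.
Qed.

Lemma at_right_affine_pos (a b : R) :
  0 < a -> at_right 0 (fun t => 0 < a + t * b).
Proof.
intros Ha. apply filter_le_within.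
assert (C : continuous (fun t : R => a + t * b) 0).
{ apply (ex_derive_continuous (fun t : R => a + t * b)). now auto_derive. }
apply C. apply (open_gt 0). lra.
Qed.

Lemma at_right_pos : at_right 0 (fun t => 0 < t).
Proof. unfold at_right, within. now apply filter_forall. Qed.

(** If the rise [d] along the chord exceeded the directional derivative, then just after time 0 the
    graph of [u] would lie below the chord, against concavity. *)
Lemma concave_tangent_ineq (u : R * R -> R) (x y a b : R) :
  property_III u -> pos_quadrant (x, y) -> pos_quadrant (x + a, y + b) ->
  u (x + a, y + b) - u (x, y) <= partial_x u (x, y) * a + partial_y u (x, y) * b.
Proof.
intros [Hdiff Hconc] H0 H1.
apply Rnot_lt_le. intros Hlt.
set (d := u (x + a, y + b) - u (x, y)) in *.
assert (Hg : is_derive (fun t => u (x + t * a, y + t * b) - t * d) 0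
               (partial_x u (x, y) * a + partial_y u (x, y) * b - d)).
{ apply (is_derive_minus (fun t => u (x + t * a, y + t * b)) (fun t => t * d)).
  - now apply is_derive_direction, Hdiff.
  - auto_derive; [ easy | ring ]. }
apply at_right_lt_of_derive_neg in Hg; [ | lra ].
assert (Hlt1 : at_right 0 (fun t => 0 < 1 + t * -1)).
{ apply at_right_affine_pos. lra. }
destruct (Hierarchy.filter_ex _ (filter_and _ _ (at_right_pos)
            (filter_and _ _ Hg Hlt1))) as [t [Ht0 [Ht Ht1]]].
(* Strict concavity speaks of distinct points; if they coincide, both sides of [Hlt] are 0. *)
assert (Hne : (x + a, y + b) <> (x, y)).
{ intros He. unfold d in Hlt. rewrite He in Hlt.
  injection He as Ha Hb. replace a with 0 in Hlt by lra.
  replace b with 0 in Hlt by lra. lra. }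
specialize (Hconc (x + a, y + b) (x, y) t H1 H0 Hne ltac:(lra)).
replace (plus (scal t (x + a, y + b)) (scal (1 - t) (x, y)))
  with (x + t * a, y + t * b) in Hconc
  by (unfold plus, scal; simpl; unfold prod_plus, prod_scal, plus, scal; simpl;
      unfold mult; simpl; f_equal; ring).
replace (x + 0 * a) with x in Ht by ring.
replace (y + 0 * b) with y in Ht by ring.
unfold d in Ht. nra.
Qed.

(** Monotonicity alone would only give a nonnegative derivative; by concavity it is at least the
    positive increment of [u] over a unit step. *)
Lemma partial_x_pos (u : R * R -> R) (r : R * R) :
  property_I u -> property_III u -> pos_quadrant r -> 0 < partial_x u r.
Proof.
destruct r as [x y]. intros (_ & _ & _ & Hincr & _) H3 [Hx Hy]; simpl in *.
assert (H := concave_tangent_ineq u x y 1 0 H3 (conj Hx Hy)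
               ltac:(split; simpl; lra)).
specialize (Hincr x (x + 1) y Hx Hy ltac:(lra)).
replace (y + 0) with y in H by ring. lra.
Qed.

Lemma partial_y_pos (u : R * R -> R) (r : R * R) :
  property_I u -> property_III u -> pos_quadrant r -> 0 < partial_y u r.
Proof.
destruct r as [x y]. intros (_ & _ & _ & _ & Hincr) H3 [Hx Hy]; simpl in *.
assert (H := concave_tangent_ineq u x y 0 1 H3 (conj Hx Hy)
               ltac:(split; simpl; lra)).
specialize (Hincr x y (y + 1) Hx Hy ltac:(lra)).
replace (x + 0) with x in H by ring. lra.
Qed.

Lemma value_pos (u : R * R -> R) (r : R * R) :
  maps_quadrant_to_nonneg u -> property_I u -> pos_quadrant r -> 0 < u r.
Proof.
destruct r as [x y]. intros Hnn (_ & _ & _ & Hincr & _) [Hx Hy]; simpl in *.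
assert (H := Hnn (x / 2, y) ltac:(split; simpl; lra)).
specialize (Hincr (x / 2) x y ltac:(lra) Hy ltac:(lra)). lra.
Qed.

(** As [u] vanishes on the axes, this keeps the end points of a trade in the open quadrant, where
    the tangent inequality applies. *)
Lemma pos_quadrant_of_value_pos (u : R * R -> R) (r : R * R) :
  property_I u -> nonneg_quadrant r -> 0 < u r -> pos_quadrant r.
Proof.
destruct r as [x y]. intros (_ & Hx0 & H0y & _) [Hx Hy] Hu; simpl in *.
split; simpl; apply Rnot_le_lt; intros Hle.
- replace x with 0 in Hu by lra. rewrite H0y in Hu; lra.
- replace y with 0 in Hu by lra. rewrite Hx0 in Hu; lra.
Qed.

Lemma level_curve_in_segment (u : R * R -> R) (x y1 y2 c : R) :
  property_III u -> 0 < x -> 0 < y1 -> y1 < y2 ->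
  u (x, y1) < c < u (x, y2) -> exists y, y1 <= y <= y2 /\ u (x, y) = c.
Proof.
intros [Hdiff _] Hx Hy1 Hy12 Hc.
destruct (IVT_interv (fun y => u (x, y) - c) y1 y2) as [y [Hy Huy]]; try lra.
- intros y Hy. apply continuity_pt_filterlim.
  apply (ex_derive_continuous (fun y => u (x, y) - c)).
  destruct (Hdiff (x, y)) as [[L HL] _]; [ split; simpl; lra | ].
  exists (minus (L (0, 1)) 0).
  apply (is_derive_minus (fun y => u (x, y)) (fun _ => c)).
  + apply (is_derive_ext (fun t => u (x + t * 0, 0 + t * 1))).
    * intros t. simpl. f_equal; f_equal; ring.
    * apply is_derive_along_line.
      now replace (x + y * 0, 0 + y * 1) with (x, y) by (f_equal; ring).
  + apply (is_derive_const c y).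
- exists y. split; [ easy | lra ].
Qed.

Lemma no_improving_trade_of_price_eq (phi u : R * R -> R) (r0 r : R * R) :
  properties_I_to_IV phi -> properties_I_to_IV u ->
  pos_quadrant r0 -> pos_quadrant r -> price phi r0 = price u r ->
  ~ has_improving_trade phi u r0 r.
Proof.
intros (Pnn & P1 & _ & P3 & _) (Unn & U1 & _ & U3 & _) H0 Hr Hp
  [h [[Hn0 [Hlev Hn]] Himp]].
assert (Q0 : pos_quadrant (plus r0 h)).
{ apply (pos_quadrant_of_value_pos phi); trivial.
  rewrite Hlev. now apply value_pos. }
assert (Q : pos_quadrant (minus r h)).
{ apply (pos_quadrant_of_value_pos u); trivial.
  assert (H := value_pos u r Unn U1 Hr). lra. }
assert (px := partial_x_pos phi r0 P1 P3 H0).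
assert (py := partial_y_pos phi r0 P1 P3 H0).
assert (ux := partial_x_pos u r U1 U3 Hr).
assert (uy := partial_y_pos u r U1 U3 Hr).
unfold price in Hp.
destruct r0 as [x0 y0], r as [x y], h as [a b].
change (plus (x0, y0) (a, b)) with (x0 + a, y0 + b) in *.
change (minus (x, y) (a, b)) with (x + - a, y + - b) in *.
assert (T0 := concave_tangent_ineq phi x0 y0 a b P3 H0 Q0).
assert (T := concave_tangent_ineq u x y (- a) (- b) U3 Hr Q).
(* Dividing each tangent inequality by its second partial derivative gives opposite signs to the
   value of the trade at the common price. *)
assert (Hv0 : 0 <= partial_x phi (x0, y0) / partial_y phi (x0, y0) * a + b).
{ apply (Rmult_le_reg_l (partial_y phi (x0, y0))); trivial.
  field_simplify; lra. }
assert (Hv : partial_x u (x, y) / partial_y u (x, y) * a + b < 0).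
{ apply (Rmult_lt_reg_l (partial_y u (x, y))); trivial.
  field_simplify; lra. }
rewrite Hp in Hv0. lra.
Qed.

Lemma price_eq_of_no_improving_trade (phi u : R * R -> R) (r0 r : R * R) :
  properties_I_to_IV phi -> properties_I_to_IV u ->
  pos_quadrant r0 -> pos_quadrant r -> ~ has_improving_trade phi u r0 r ->
  price phi r0 = price u r.
Proof.
intros (Pnn & P1 & _ & P3 & _) (Unn & U1 & _ & U3 & _) H0 Hr Hno.
assert (px := partial_x_pos phi r0 P1 P3 H0).
assert (py := partial_y_pos phi r0 P1 P3 H0).
assert (ux := partial_x_pos u r U1 U3 Hr).
assert (uy := partial_y_pos u r U1 U3 Hr).
destruct r0 as [x0 y0], r as [x y].
assert (Dphi := proj1 (proj1 P3 _ H0)).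
assert (Du := proj1 (proj1 U3 _ Hr)).
destruct H0 as [Hx0 Hy0], Hr as [Hx Hy]; simpl in *.
unfold price.
set (A := partial_x phi (x0, y0)) in *. set (B := partial_y phi (x0, y0)) in *.
set (C := partial_x u (x, y)) in *. set (D := partial_y u (x, y)) in *.
destruct (Req_dec (C * B) (A * D)) as [He | Hne].
{ apply (Rmult_eq_reg_l (B * D)); [ field_simplify; lra | nra ]. }
exfalso; apply Hno; clear Hno.
(* [(a, b)] is tangent to the level curve and decreases [u]; the tilt [c] is
   small enough for [(a, b + c)] to still decrease [u] *)
assert (Hv : exists a b c, A * a + B * b = 0 /\ 0 < c /\ C * a + D * (b + c) < 0).
{ destruct (Rdichotomy _ _ Hne) as [Hlt | Hgt].
  - exists B, (- A), ((A * D - C * B) / (2 * D)). split; [ ring | split ].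
    + apply Rdiv_lt_0_compat; lra.
    + field_simplify; lra.
  - exists (- B), A, ((C * B - A * D) / (2 * D)). split; [ ring | split ].
    + apply Rdiv_lt_0_compat; lra.
    + field_simplify; lra. }
destruct Hv as (a & b & c & Htan & Hc & Hdec).
(* By tangency, the slopes of [phi] along the two tilted directions are [B * c] and [- (B * c)]. *)
assert (Eup : at_right 0 (fun t => phi (x0, y0) < phi (x0 + t * a, y0 + t * (b + c)))).
{ generalize (at_right_gt_of_derive_pos _ _ _
                (is_derive_direction phi x0 y0 a (b + c) Dphi)).
  rewrite !Rmult_0_l, !Rplus_0_r. intros H; apply H. fold A B. nra. }
assert (Edown : at_right 0 (fun t => phi (x0 + t * a, y0 + t * (b - c)) < phi (x0, y0))).
{ generalize (at_right_lt_of_derive_neg _ _ _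
                (is_derive_direction phi x0 y0 a (b - c) Dphi)).
  rewrite !Rmult_0_l, !Rplus_0_r. intros H; apply H. fold A B. nra. }
assert (Eimp : at_right 0 (fun t => u (x, y) < u (x + t * - a, y + t * - (b + c)))).
{ generalize (at_right_gt_of_derive_pos _ _ _
                (is_derive_direction u x y (- a) (- (b + c)) Du)).
  rewrite !Rmult_0_l, !Rplus_0_r. intros H; apply H. fold C D. nra. }
(* Positivity is asked at the lower end for [phi] and at the largest payment for the agent; every
   [z] in between inherits it. *)
destruct (Hierarchy.filter_ex _
  (filter_and _ _ at_right_pos (filter_and _ _ Eup (filter_and _ _ Edown
  (filter_and _ _ Eimp (filter_and _ _ (at_right_affine_pos x0 a Hx0)
  (filter_and _ _ (at_right_affine_pos y0 (b - c) Hy0)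
  (filter_and _ _ (at_right_affine_pos x (- a) Hx)
     (at_right_affine_pos y (- (b + c)) Hy))))))))) as
  [t (Ht & Hup & Hdown & Himp & Px0 & Py0 & Px & Py)].
assert (Htc := Rmult_lt_0_compat t c Ht Hc).
destruct (level_curve_in_segment phi (x0 + t * a) (y0 + t * (b - c))
            (y0 + t * (b + c)) (phi (x0, y0))) as [z [Hz Hlev]];
  trivial; [ nra | now split | ].
exists (t * a, z - y0). unfold valid_trade.
change (plus (x0, y0) (t * a, z - y0)) with (x0 + t * a, y0 + (z - y0)).
change (minus (x, y) (t * a, z - y0)) with (x + - (t * a), y + - (z - y0)).
replace (y0 + (z - y0)) with z by ring.
replace (x + - (t * a)) with (x + t * - a) by ring.
split; [ split; [ | split ]; trivial; split; simpl; nra | ].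
(* Since [z - y0 <= t * (b + c)], the agent keeps at least as much of the second good as along the
   upward tilt, so monotonicity preserves the gain. *)
apply Rlt_le_trans with (1 := Himp).
destruct U1 as (_ & _ & _ & _ & Hincr).
destruct (Rle_lt_or_eq_dec (y + t * - (b + c)) (y + - (z - y0))) as [Hlt | <-].
- lra.
- left. now apply Hincr.
- apply Rle_refl.
Qed.

Theorem theorem1 (phi u1 u2 : R * R -> R) (r0 r1 r2 : R * R)
    (hphi : properties_I_to_IV phi)
    (hu1 : properties_I_to_IV u1)
    (hu2 : properties_I_to_IV u2)
    (hr0 : pos_quadrant r0) (hr1 : pos_quadrant r1) (hr2 : pos_quadrant r2) :
  unilateral_equilibrium phi u1 u2 r0 r1 r2 <->
  price phi r0 = price u1 r1 /\ price u1 r1 = price u2 r2.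
Proof.
split.
- intros [H1 H2].
  apply price_eq_of_no_improving_trade in H1, H2; trivial.
  split; congruence.
- intros [H1 H2].
  split; apply no_improving_trade_of_price_eq; trivial; congruence.
Qed.
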